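(* Let $P$ be a finite set of propositions, $\Pi=2^P$, $\phi$ a formula of the LTL fragment described in the context, $\pi\in\Pi^*$ a finite trace and $i\in\mathbb{N}_{>0}$. Then $\mu_\pi(\phi,i)=\top \iff e_\pi(\phi,i)=\top$, $\mu_\pi(\phi,i)=\bot \iff e_\pi(\phi,i)=\bot$, $\mu_\pi(\phi,i)=\,? \iff e_\pi(\phi,i)\in\{\top_P,\bot_P,?\}$.
   Context: Traces $\pi=\pi_1\dots\pi_{|\pi|}$ over $\Pi$. Formulas: $\phi ::= p \mid \neg\phi \mid \phi_1\vee\phi_2 \mid \mathbf{X}\phi \mid \phi_1\,\mathbf{U}\,\phi_2 \mid \mathbf{F}\phi$, $p\in P$. Three-valued semantics $\mu_\pi(\phi,i)\in\{\bot,?,\top\}$ ($\bot<?<\top$, $\neg_3$ swaps $\top,\bot$ and fixes $?$, $\vee_3=\max$, $\wedge_3=\min$): $\mu_\pi(p,i)=\top$ if $i\le|\pi|,p\in\pi_i$; $\bot$ if $i\le|\pi|,p\notin\pi_i$; $?$ if $i>|\pi|$; $\mu_\pi(\neg\phi,i)=\neg_3\mu_\pi(\phi,i)$; $\mu_\pi(\phi_1\vee\phi_2,i)=\mu_\pi(\phi_1,i)\vee_3\mu_\pi(\phi_2,i)$; $\mu_\pi(\mathbf{X}\phi,i)=\mu_\pi(\phi,i+1)$; $\mu_\pi(\mathbf{F}\phi,i)=\mu_\pi(\phi,i)\vee_3\mu_\pi(\mathbf{X}\mathbf{F}\phi,i)$ if $i\le|\pi|$, else $\mu_\pi(\phi,i)$;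 $\mu_\pi(\phi_1\mathbf{U}\phi_2,i)=\mu_\pi(\phi_2,i)\vee_3(\mu_\pi(\phi_1,i)\wedge_3\mu_\pi(\mathbf{X}(\phi_1\mathbf{U}\phi_2),i))$ if $i\le|\pi|$, else $\mu_\pi(\phi_2,i)$. Counting semantics: $\mathbb{N}_+=\mathbb{N}_0\cup\{\infty,-\}$ ordered $n<\infty<-$; $a\oplus b=a+b$ if $a,b\in\mathbb{N}_0$, else $\max\{a,b\}$; $\mathrm{swap}(s,f)=(f,s)$; $(s,f)\oplus1=(s\oplus1,f\oplus1)$; $(s,f)\sqcup(s',f')=(\min(s,s'),\max(f,f'))$; $(s,f)\sqcap(s',f')=(\max(s,s'),\min(f,f'))$. $d_\pi(p,i)=(0,-)$ if $i\le|\pi|,p\in\pi_i$; $(-,0)$ if $i\le|\pi|,p\notin\pi_i$; $(0,0)$ if $i>|\pi|$; $d_\pi(\neg\phi,i)=\mathrm{swap}\,d_\pi(\phi,i)$; $d_\pi(\phi_1\vee\phi_2,i)=d_\pi(\phi_1,i)\sqcup d_\pi(\phi_2,i)$; $d_\pi(\mathbf{X}\phi,i)=d_\pi(\phi,i+1)\oplus1$; $d_\pi(\phi\mathbf{U}\psi,i)=d_\pi(\psi,i)\sqcup(d_\pi(\phi,i)\sqcap d_\pi(\mathbf{X}(\phi\mathbf{U}\psi),i))$ if $i\le|\pi|$, else $d_\pi(\psi,i)\sqcup(d_\pi(\phi,i)\sqcap(-,\infty))$; $d_\pi(\mathbf{F}\phi,i)=d_\pi(\phi,i)\sqcup d_\pi(\mathbf{X}\mathbf{F}\phi,i)$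 if $i\le|\pi|$, else $d_\pi(\phi,i)\sqcup(-,\infty)$. Write $d_\pi(\phi,i)=(s_\pi(\phi,i),f_\pi(\phi,i))$. Five-valued domain $\bot<\bot_P<?<\top_P<\top$ with $\neg$ exchanging $\top\leftrightarrow\bot$, $\top_P\leftrightarrow\bot_P$, fixing $?$; $x\vee y=\max$, $x\wedge y=\neg(\neg x\vee\neg y)$. Prediction predicate $\mathrm{pred}_\pi(\phi,i)\in\{\bot,?,\top\}$ (ordered $\bot<?<\top$): $=\top$ if there is $j<i$ with $d_\pi(\phi,j)=(s',-)$ and $s_\pi(\phi,i)\le s'$; $=\,?$ if there is no $j<i$ with $d_\pi(\phi,j)$ of the form $(s',-)$; $=\bot$ if such $j<i$ exists and $s_\pi(\phi,i)>\max\{s' \mid j<i,\ d_\pi(\phi,j)=(s',-)\}$. Predictive evaluation $e_\pi(\phi,i)$, where $a,b_1,b_2\in\mathbb{N}_0$, $a\le|\pi|-i$, $b_j>|\pi|-i$: if $d_\pi(\phi,i)=(a,-)$ then $\top$; if $d_\pi(\phi,i)=(b_1,b_2)$ then $\top_P$ if $\mathrm{pred}_\pi(\phi,i)>\mathrm{pred}_\pi(\neg\phi,i)$, $r_\pi(\phi,i)$ if they are equal, $\bot_P$ if $\mathrm{pred}_\pi(\phi,i)<\mathrm{pred}_\pi(\neg\phi,i)$; if $d_\pi(\phi,i)=(b_1,\infty)$ then $\top_P$, $r_\pi(\phi,i)$, $\bot_P$ according as $\mathrm{pred}_\pi(\phi,i)$ is $\top$, $?$, $\bot$; if $d_\pi(\phi,i)=(\infty,b_1)$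 then $\neg e_\pi(\neg\phi,i)$; if $d_\pi(\phi,i)=(\infty,\infty)$ then $r_\pi(\phi,i)$; if $d_\pi(\phi,i)=(-,a)$ then $\bot$. Auxiliary $r_\pi$: $r_\pi(p,i)=\,?$; $r_\pi(\neg\phi,i)=\neg e_\pi(\phi,i)$; $r_\pi(\phi_1\vee\phi_2,i)=e_\pi(\phi_1,i)\vee e_\pi(\phi_2,i)$; $r_\pi(\mathbf{X}^n\phi,i)=e_\pi(\phi,i+n)$ ($n\ge1$ the number of leading $\mathbf{X}$ operators); $r_\pi(\mathbf{F}\phi,i)=e_\pi(\phi,i)\vee r_\pi(\mathbf{X}\mathbf{F}\phi,i)$ if $i\le|\pi|$, else $e_\pi(\phi,i)$; $r_\pi(\phi_1\mathbf{U}\phi_2,i)=e_\pi(\phi_2,i)\vee(e_\pi(\phi_1,i)\wedge e_\pi(\mathbf{X}(\phi_1\mathbf{U}\phi_2),i))$ if $i\le|\pi|$, else $e_\pi(\phi_2,i)$.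
   Formalization: When d(φ,i)=(∞,b) and pred(¬φ,i)=?, the clauses for e and r are circular (e(φ,i)=¬e(¬φ,i)=¬r(¬φ,i)=e(φ,i)) and leave e undetermined; there e(φ,i) is taken to be r(φ,i), and all stated clauses still hold. *)

(* Defs.v *)
From HB Require Import structures.
From mathcomp Require Import all_boot all_order.

Set Implicit Arguments.
Unset Strict Implicit.
Unset Printing Implicit Defensive.

Import Order.TTheory.

Inductive verdict3 := Bot3 | Unk3 | Top3.

Definition rank3 (x : verdict3) : nat :=
  match x with Bot3 => 0 | Unk3 => 1 | Top3 => 2 end.

Definition unrank3 (n : nat) : option verdict3 :=
  match n with 0 => Some Bot3 | 1 => Some Unk3 | 2 => Some Top3 | _ => None end.

Lemma rank3K : pcancel rank3 unrank3.
Proof. by case. Qed.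

HB.instance Definition _ := Choice.copy verdict3 (pcan_type rank3K).

Definition le3 (x y : verdict3) : bool := rank3 x <= rank3 y.

Lemma le3_anti : antisymmetric le3.
Proof. by case; case. Qed.

Lemma le3_trans : transitive le3.
Proof. by case; case; case. Qed.

Lemma le3_total : total le3.
Proof. by case; case. Qed.

Fact verdict3_display : Order.disp_t. Proof. exact: Order.Disp tt tt. Qed.

HB.instance Definition _ := Order.isOrder.Build verdict3_display verdict3
  (fun _ _ => erefl) (fun _ _ => erefl) (fun _ _ => erefl)
  le3_anti le3_trans le3_total.

Definition neg3 (x : verdict3) : verdict3 :=
  match x with Bot3 => Top3 | Unk3 => Unk3 | Top3 => Bot3 end.

Definition vee3 (x y : verdict3) : verdict3 := Order.max x y.
Definition wedge3 (x y : verdict3) : verdict3 := Order.min x y.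

Inductive verdict5 := Bot5 | PBot5 | Unk5 | PTop5 | Top5.

Definition rank5 (x : verdict5) : nat :=
  match x with Bot5 => 0 | PBot5 => 1 | Unk5 => 2 | PTop5 => 3 | Top5 => 4 end.

Definition unrank5 (n : nat) : option verdict5 :=
  match n with
  | 0 => Some Bot5 | 1 => Some PBot5 | 2 => Some Unk5
  | 3 => Some PTop5 | 4 => Some Top5 | _ => None
  end.

Lemma rank5K : pcancel rank5 unrank5.
Proof. by case. Qed.

HB.instance Definition _ := Choice.copy verdict5 (pcan_type rank5K).

Definition le5 (x y : verdict5) : bool := rank5 x <= rank5 y.

Lemma le5_anti : antisymmetric le5.
Proof. by case; case. Qed.

Lemma le5_trans : transitive le5.
Proof. by case; case; case. Qed.

Lemma le5_total : total le5.
Proof. by case; case. Qed.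

Fact verdict5_display : Order.disp_t. Proof. exact: Order.Disp tt tt. Qed.

HB.instance Definition _ := Order.isOrder.Build verdict5_display verdict5
  (fun _ _ => erefl) (fun _ _ => erefl) (fun _ _ => erefl)
  le5_anti le5_trans le5_total.

Definition neg5 (x : verdict5) : verdict5 :=
  match x with
  | Bot5 => Top5 | PBot5 => PTop5 | Unk5 => Unk5 | PTop5 => PBot5 | Top5 => Bot5
  end.

Definition vee5 (x y : verdict5) : verdict5 := Order.max x y.
Definition wedge5 (x y : verdict5) : verdict5 := neg5 (vee5 (neg5 x) (neg5 y)).

Lemma neg5K : involutive neg5.
Proof. by case. Qed.

(* The naturals extended with infinity and, above it, the symbol "-". *)
Inductive ncount := Fin of nat | Inf | Dash.

Definition ncount_encode (a : ncount) : option (option nat) :=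
  match a with Fin n => Some (Some n) | Inf => Some None | Dash => None end.

Definition ncount_decode (x : option (option nat)) : ncount :=
  match x with Some (Some n) => Fin n | Some None => Inf | None => Dash end.

Lemma ncount_encodeK : cancel ncount_encode ncount_decode.
Proof. by case. Qed.

HB.instance Definition _ := Choice.copy ncount (can_type ncount_encodeK).

Definition ncount_le (a b : ncount) : bool :=
  match a, b with
  | Fin m, Fin n => m <= n
  | Fin _, _ => true
  | Inf, Fin _ => false
  | Inf, _ => true
  | Dash, Dash => true
  | Dash, _ => false
  end.

Lemma ncount_le_anti : antisymmetric ncount_le.
Proof. by case=> [m||] [n||] //= /anti_leq ->. Qed.

Lemma ncount_le_trans : transitive ncount_le.
Proof. by case=> [m||] [n||] [p||] //=; apply: leq_trans. Qed.

Lemma ncount_le_total : total ncount_le.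
Proof. by case=> [m||] [n||] //=; apply: leq_total. Qed.

Fact ncount_display : Order.disp_t. Proof. exact: Order.Disp tt tt. Qed.

HB.instance Definition _ := Order.isOrder.Build ncount_display ncount
  (fun _ _ => erefl) (fun _ _ => erefl) (fun _ _ => erefl)
  ncount_le_anti ncount_le_trans ncount_le_total.

Definition ncount_add (a b : ncount) : ncount :=
  match a, b with Fin m, Fin n => Fin (m + n) | _, _ => Order.max a b end.

Definition swap (x : ncount * ncount) : ncount * ncount := (x.2, x.1).

Definition shift (x : ncount * ncount) : ncount * ncount :=
  (ncount_add x.1 (Fin 1), ncount_add x.2 (Fin 1)).

Definition sqcup (x y : ncount * ncount) : ncount * ncount :=
  (Order.min x.1 y.1, Order.max x.2 y.2).

Definition sqcap (x y : ncount * ncount) : ncount * ncount :=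
  (Order.max x.1 y.1, Order.min x.2 y.2).

Inductive formula (P : finType) :=
| Atom of P
| Neg of formula P
| Or of formula P & formula P
| Next of formula P
| Until of formula P & formula P
| Finally of formula P.

Arguments Atom {P}.

(* Traces are sequences of letters and positions are counted from 1. *)
Definition letter (P : finType) (pi : seq {set P}) (i : nat) : {set P} :=
  nth set0 pi i.-1.

Fixpoint unroll (T : Type) (step : nat -> T -> T) (base : nat -> T)
    (k i : nat) : T :=
  if k is k'.+1 then step i (unroll step base k' i.+1) else base i.

(* The solution v of  v i = step i (v i.+1) for i <= n,  v i = base i for     *)
(* i > n; this is how the clauses for U and F, which refer to their own value *)
(* at the next position, are turned into definitions by structural recursion  *)
(* on the formula.                                                            *)
Definition upto (T : Type) (n : nat) (step : nat -> T -> T) (base : nat -> T)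
    (i : nat) : T :=
  unroll step base (n.+1 - i) i.

Lemma uptoE (T : Type) n (step : nat -> T -> T) (base : nat -> T) i :
  upto n step base i =
    if i <= n then step i (upto n step base i.+1) else base i.
Proof.
rewrite /upto; case: leqP => [le_in | lt_ni]; first by rewrite subSn.
by have /eqP-> : n.+1 - i == 0 by rewrite subn_eq0.
Qed.

Fixpoint mu (P : finType) (pi : seq {set P}) (phi : formula P) (i : nat)
    {struct phi} : verdict3 :=
  match phi with
  | Atom p =>
      if i <= size pi then (if p \in letter pi i then Top3 else Bot3) else Unk3
  | Neg phi1 => neg3 (mu pi phi1 i)
  | Or phi1 phi2 => vee3 (mu pi phi1 i) (mu pi phi2 i)
  | Next phi1 => mu pi phi1 i.+1
  | Until phi1 phi2 =>
      upto (size pi)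
        (fun j next => vee3 (mu pi phi2 j) (wedge3 (mu pi phi1 j) next))
        (fun j => mu pi phi2 j) i
  | Finally phi1 =>
      upto (size pi)
        (fun j next => vee3 (mu pi phi1 j) next)
        (fun j => mu pi phi1 j) i
  end.

Lemma mu_Until (P : finType) (pi : seq {set P}) phi1 phi2 i :
  mu pi (Until phi1 phi2) i =
    if i <= size pi then
      vee3 (mu pi phi2 i)
          (wedge3 (mu pi phi1 i) (mu pi (Next (Until phi1 phi2)) i))
    else mu pi phi2 i.
Proof. by rewrite /= uptoE. Qed.

Lemma mu_Finally (P : finType) (pi : seq {set P}) phi i :
  mu pi (Finally phi) i =
    if i <= size pi then vee3 (mu pi phi i) (mu pi (Next (Finally phi)) i)
    else mu pi phi i.
Proof. by rewrite /= uptoE. Qed.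

Fixpoint dist (P : finType) (pi : seq {set P}) (phi : formula P) (i : nat)
    {struct phi} : ncount * ncount :=
  match phi with
  | Atom p =>
      if i <= size pi then
        (if p \in letter pi i then (Fin 0, Dash) else (Dash, Fin 0))
      else (Fin 0, Fin 0)
  | Neg phi1 => swap (dist pi phi1 i)
  | Or phi1 phi2 => sqcup (dist pi phi1 i) (dist pi phi2 i)
  | Next phi1 => shift (dist pi phi1 i.+1)
  | Until phi1 phi2 =>
      upto (size pi)
        (fun j next => sqcup (dist pi phi2 j) (sqcap (dist pi phi1 j) (shift next)))
        (fun j => sqcup (dist pi phi2 j) (sqcap (dist pi phi1 j) (Dash, Inf))) i
  | Finally phi1 =>
      upto (size pi)
        (fun j next => sqcup (dist pi phi1 j) (shift next))
        (fun j => sqcup (dist pi phi1 j) (Dash, Inf)) i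
  end.

Lemma dist_Until (P : finType) (pi : seq {set P}) phi1 phi2 i :
  dist pi (Until phi1 phi2) i =
    if i <= size pi then
      sqcup (dist pi phi2 i)
            (sqcap (dist pi phi1 i) (dist pi (Next (Until phi1 phi2)) i))
    else sqcup (dist pi phi2 i) (sqcap (dist pi phi1 i) (Dash, Inf)).
Proof. by rewrite /= uptoE. Qed.

Lemma dist_Finally (P : finType) (pi : seq {set P}) phi i :
  dist pi (Finally phi) i =
    if i <= size pi then
      sqcup (dist pi phi i) (dist pi (Next (Finally phi)) i)
    else sqcup (dist pi phi i) (Dash, Inf).
Proof. by rewrite /= uptoE. Qed.

(* The values s' with dist pi phi j = (s', -) at the positions 0 < j < i. *)
Definition past_witnesses (P : finType) (pi : seq {set P}) (phi : formula P)
    (i : nat) : seq ncount :=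
  pmap (fun j => if dist pi phi j is (s', Dash) then Some s' else None)
       (iota 1 i.-1).

Definition prediction (P : finType) (pi : seq {set P}) (phi : formula P) (i : nat)
    : verdict3 :=
  let s := (dist pi phi i).1 in
  let past := past_witnesses pi phi i in
  if has (fun s' => (s <= s')%O) past then Top3
  else if nilp past then Unk3
  else Bot3.

Lemma prediction_Bot (P : finType) (pi : seq {set P}) phi i :
  ~~ nilp (past_witnesses pi phi i) ->
  prediction pi phi i = Bot3 <->
  (\big[Order.max/Fin 0]_(s' <- past_witnesses pi phi i) s'
     < (dist pi phi i).1)%O.
Proof.
rewrite /prediction; set s := (dist pi phi i).1.
set past := past_witnesses pi phi i => /[dup] past_n0 /negbTE ->.
have -> : (\big[Order.max/Fin 0]_(s' <- past) s' < s)%O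
          = ~~ has (fun s' => (s <= s')%O) past.
  elim: past past_n0 => // x [|y past] IH _; last first.
    by rewrite big_cons gt_max IH //= !negb_or -!ltNge.
  rewrite big_cons big_nil gt_max /= orbF -ltNge andb_idr //.
  by apply: le_lt_trans; case: x {IH}.
by case: has.
Qed.

Definition by_prediction (p : verdict3) (r : verdict5) : verdict5 :=
  match p with Top3 => PTop5 | Unk3 => r | Bot3 => PBot5 end.

(* The predictive evaluation of phi at i, as a function of the value r of the *)
(* auxiliary function at (phi, i). The condition a <= |pi| - i, where the     *)
(* difference may be negative, is written a + i <= |pi|.                      *)
(*   In the case (oo, b) the value has to be the negation of the evaluation   *)
(* of Neg phi, whose count is (b, oo). When the prediction for Neg phi is     *)
(* inconclusive, that evaluation is the auxiliary value of Neg phi, i.e. the  *)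
(* negation of the evaluation of phi: the clauses then only say that the      *)
(* value equals itself. This cycle is broken by taking the value r, i.e. by   *)
(* using neg5 r as the auxiliary value of Neg phi. All the clauses hold for   *)
(* the resulting functions (lemmas aux_* and eval_* below).                   *)
(*   No count falls in the remaining cases, which get the value Unk5.         *)
Definition eval_with (P : finType) (pi : seq {set P}) (phi : formula P)
    (i : nat) (r : verdict5) : verdict5 :=
  let within a := a + i <= size pi in
  match dist pi phi i with
  | (Fin a, Dash) => if within a then Top5 else Unk5
  | (Fin b1, Fin b2) =>
      if ~~ within b1 && ~~ within b2 then
        if (prediction pi phi i > prediction pi (Neg phi) i)%O then PTop5
        else if prediction pi phi i == prediction pi (Neg phi) i then r
        else PBot5
      else Unk5
  | (Fin b1, Inf) =>
      if ~~ within b1 then by_prediction (prediction pi phi i) r else Unk5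
  | (Inf, Fin b1) =>
      if ~~ within b1 then neg5 (by_prediction (prediction pi (Neg phi) i) (neg5 r))
      else Unk5
  | (Inf, Inf) => r
  | (Dash, Fin a) => if within a then Bot5 else Unk5
  | _ => Unk5
  end.

Definition is_Next (P : finType) (phi : formula P) : bool :=
  if phi is Next _ then true else false.

(* In the cases of U and F, next is the auxiliary value of the same formula   *)
(* at the following position.                                                 *)
Fixpoint aux (P : finType) (pi : seq {set P}) (phi : formula P) (i : nat)
    {struct phi} : verdict5 :=
  match phi with
  | Atom _ => Unk5
  | Neg phi1 => neg5 (eval_with pi phi1 i (aux pi phi1 i))
  | Or phi1 phi2 =>
      vee5 (eval_with pi phi1 i (aux pi phi1 i))
          (eval_with pi phi2 i (aux pi phi2 i))
  | Next phi1 =>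
      if is_Next phi1 then aux pi phi1 i.+1
      else eval_with pi phi1 i.+1 (aux pi phi1 i.+1)
  | Until phi1 phi2 =>
      upto (size pi)
        (fun j next =>
           vee5 (eval_with pi phi2 j (aux pi phi2 j))
               (wedge5 (eval_with pi phi1 j (aux pi phi1 j))
                     (eval_with pi (Next phi) j (eval_with pi phi j.+1 next))))
        (fun j => eval_with pi phi2 j (aux pi phi2 j)) i
  | Finally phi1 =>
      upto (size pi)
        (fun j next =>
           vee5 (eval_with pi phi1 j (aux pi phi1 j))
               (eval_with pi phi j.+1 next))
        (fun j => eval_with pi phi1 j (aux pi phi1 j)) i
  end.

Definition eval (P : finType) (pi : seq {set P}) (phi : formula P) (i : nat)
    : verdict5 :=
  eval_with pi phi i (aux pi phi i).

Lemma aux_Atom (P : finType) (pi : seq {set P}) p i :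
  aux pi (Atom p) i = Unk5.
Proof. by []. Qed.

Lemma aux_Neg (P : finType) (pi : seq {set P}) phi i :
  aux pi (Neg phi) i = neg5 (eval pi phi i).
Proof. by []. Qed.

Lemma aux_Or (P : finType) (pi : seq {set P}) phi1 phi2 i :
  aux pi (Or phi1 phi2) i = vee5 (eval pi phi1 i) (eval pi phi2 i).
Proof. by []. Qed.

Lemma aux_iter_Next (P : finType) (pi : seq {set P}) (phi : formula P) n i :
  0 < n -> ~~ is_Next phi ->
  aux pi (iter n (@Next P) phi) i = eval pi phi (i + n).
Proof.
case: n => // n _ nX; elim: n i => [|n IH] i.
  by rewrite addn1 /= (negbTE nX).
by rewrite -addSnnS -IH.
Qed.

Lemma aux_Until (P : finType) (pi : seq {set P}) phi1 phi2 i :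
  aux pi (Until phi1 phi2) i =
    if i <= size pi then
      vee5 (eval pi phi2 i)
          (wedge5 (eval pi phi1 i) (eval pi (Next (Until phi1 phi2)) i))
    else eval pi phi2 i.
Proof. by rewrite /= uptoE. Qed.

Lemma aux_Finally (P : finType) (pi : seq {set P}) phi i :
  aux pi (Finally phi) i =
    if i <= size pi then vee5 (eval pi phi i) (aux pi (Next (Finally phi)) i)
    else eval pi phi i.
Proof. by rewrite /= uptoE. Qed.

Lemma eval_FinDash (P : finType) (pi : seq {set P}) phi i a :
  dist pi phi i = (Fin a, Dash) -> a + i <= size pi ->
  eval pi phi i = Top5.
Proof. by rewrite /eval /eval_with => -> ->. Qed.

Lemma eval_FinFin (P : finType) (pi : seq {set P}) phi i b1 b2 :
  dist pi phi i = (Fin b1, Fin b2) -> size pi < b1 + i -> size pi < b2 + i ->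
  [/\ (prediction pi phi i > prediction pi (Neg phi) i)%O -> eval pi phi i = PTop5,
      prediction pi phi i = prediction pi (Neg phi) i -> eval pi phi i = aux pi phi i
    & (prediction pi phi i < prediction pi (Neg phi) i)%O -> eval pi phi i = PBot5].
Proof.
rewrite /eval /eval_with => -> b1P b2P; rewrite -!ltnNge b1P b2P.
by split=> [->|->|] //; [rewrite ltxx eqxx | case: ltgtP].
Qed.

Lemma eval_FinInf (P : finType) (pi : seq {set P}) phi i b1 :
  dist pi phi i = (Fin b1, Inf) -> size pi < b1 + i ->
  eval pi phi i =
    match prediction pi phi i with
    | Top3 => PTop5 | Unk3 => aux pi phi i | Bot3 => PBot5
    end.
Proof. by rewrite /eval /eval_with => -> b1P; rewrite -ltnNge b1P. Qed.

Lemma eval_InfFin (P : finType) (pi : seq {set P}) phi i b1 :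
  dist pi phi i = (Inf, Fin b1) -> size pi < b1 + i ->
  eval pi phi i = neg5 (eval pi (Neg phi) i).
Proof.
move=> dE b1P; rewrite (@eval_FinInf _ _ (Neg phi) _ b1) ?aux_Neg //=; last first.
  by rewrite dE.
rewrite /eval /eval_with dE -ltnNge b1P /by_prediction.
by case: prediction; rewrite ?neg5K.
Qed.

Lemma eval_InfInf (P : finType) (pi : seq {set P}) phi i :
  dist pi phi i = (Inf, Inf) -> eval pi phi i = aux pi phi i.
Proof. by rewrite /eval /eval_with => ->. Qed.

Lemma eval_DashFin (P : finType) (pi : seq {set P}) phi i a :
  dist pi phi i = (Dash, Fin a) -> a + i <= size pi ->
  eval pi phi i = Bot5.
Proof. by rewrite /eval /eval_with => -> ->. Qed.

(* Main.v *)
Require Import Defs.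
From mathcomp Require Import all_boot all_order.
From mathcomp Require Import zify.

Import Order.TTheory.

(** The count of a formula determines its three-valued verdict: the verdict is
    conclusive exactly when one component of the count is "-" and the other is
    reached within the trace, and it is "?" when each component is infinite or
    lies beyond the end of the trace. The five-valued domain projects onto the
    three-valued one by merging its three middle values, and this projection
    commutes with the connectives. So the predictive evaluation projects to the
    three-valued verdict as soon as the auxiliary value is inconclusive wherever
    the verdict is. *)

Definition beyond (n i : nat) (s : ncount) : bool :=
  match s with Fin b => n < b + i | Inf => true | Dash => false end.

Definition count_agrees (n i : nat) (v : verdict3) (d : ncount * ncount) : bool :=
  match v, d with
  | Top3, (Fin a, Dash) => a + i <= n
  | Bot3, (Dash, Fin a) => a + i <= n
  | Unk3, (s, f) => beyond n i s && beyond n i f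
  | _, _ => false
  end.

Definition project (v : verdict5) : verdict3 :=
  match v with Top5 => Top3 | Bot5 => Bot3 | _ => Unk3 end.

Lemma project_neg5 v : project (neg5 v) = neg3 (project v).
Proof. by case: v. Qed.

Lemma project_vee5 v w : project (vee5 v w) = vee3 (project v) (project w).
Proof. by case: v; case: w. Qed.

Lemma project_wedge5 v w : project (wedge5 v w) = wedge3 (project v) (project w).
Proof. by case: v; case: w. Qed.

Lemma wedge3E v w : wedge3 v w = neg3 (vee3 (neg3 v) (neg3 w)).
Proof. by case: v; case: w. Qed.

Lemma sqcapE x y : sqcap x y = swap (sqcup (swap x) (swap y)).
Proof. by []. Qed.

(** [ncount_le] computes on constructors, so order operations reduce to comparisons of naturals. *)
Lemma ncount_minE (a b : ncount) :
  Order.min a b = if ncount_le a b then a else b.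
Proof. by rewrite minEle. Qed.

Lemma ncount_maxE (a b : ncount) :
  Order.max a b = if ncount_le a b then b else a.
Proof. by rewrite maxEle. Qed.

Lemma count_agrees_swap n i v d :
  count_agrees n i v d -> count_agrees n i (neg3 v) (swap d).
Proof. by case: v d => [] [[a||] [b||]] //=; rewrite andbC. Qed.

Lemma count_agrees_sqcup n i v w d e :
  count_agrees n i v d -> count_agrees n i w e ->
  count_agrees n i (vee3 v w) (sqcup d e).
Proof.
rewrite /sqcup ncount_minE ncount_maxE.
case: v w d e => [] [] [[a||] [b||]] // [[c||] [g||]] //=;
  do ?case: ifP; rewrite /=; lia.
Qed.

Lemma count_agrees_sqcap n i v w d e :
  count_agrees n i v d -> count_agrees n i w e ->
  count_agrees n i (wedge3 v w) (sqcap d e).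
Proof.
move=> vd we; rewrite wedge3E sqcapE.
by apply/count_agrees_swap/count_agrees_sqcup; apply: count_agrees_swap.
Qed.

(** Counts are relative to the position: [a] steps from [i.+1] and [a + 1] steps from [i] end at the
    same place. *)
Lemma count_agrees_shift n i v d :
  count_agrees n i.+1 v d -> count_agrees n i v (shift d).
Proof.
by case: v d => [] [[a||] [b||]] //=; rewrite /shift /= ?ncount_maxE /= ?addn1 ?addSnnS.
Qed.

Lemma count_agrees_beyond n i v d :
  n < i -> count_agrees n i v d -> v = Unk3 /\ beyond n i d.1 && beyond n i d.2.
Proof. by case: v d => [] [[a||] [b||]] //=; lia. Qed.

(** The uses below need [sqcup d (Dash, s)], which keeps the first component of [d] and takes the
    larger of two values beyond the end. With the [sqcap] written here the first component is
    [Dash], which does not agree with [Unk3]. *)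
Lemma count_agrees_past_end n i v d s :
  n < i -> count_agrees n i v d -> beyond n i s ->
  count_agrees n i v (sqcup d (Dash, s)).
Proof.
move=> lt_ni /(count_agrees_beyond _ _ _ _ lt_ni)[-> /andP[]].
case: d s => [[a||] [b||]] [c||] //= d1 d2 sP;
  rewrite /sqcup ?ncount_minE ?ncount_maxE /= ?d1 ?d2 //; by case: ifP.
Qed.

(** Backward induction from the end of the trace, matching the recursion of [Until] and
    [Finally]. *)
Lemma trace_ind (n : nat) (Q : nat -> Prop) :
  (forall i, n < i -> Q i) -> (forall i, i <= n -> Q i.+1 -> Q i) ->
  forall i, Q i.
Proof.
move=> Qend Qstep i; have [k le_ki] := ubnP (n.+1 - i).
elim: k i le_ki => // k IH i le_ki.
by case: (leqP i n) => [le_in | /Qend //]; apply: Qstep => //; apply: IH; lia.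
Qed.

Section Trace.

Variables (P : finType) (pi : seq {set P}).
Implicit Type phi : formula P.

Lemma dist_agrees phi i : count_agrees (size pi) i (mu pi phi i) (dist pi phi i).
Proof.
elim: phi i => [p|phi IH|phi1 IH1 phi2 IH2|phi IH|phi1 IH1 phi2 IH2|phi IH] i.
- by rewrite /=; case: leqP => [le_in|lt_ni]; [case: ifP | rewrite /= lt_ni].
- exact: count_agrees_swap.
- exact: count_agrees_sqcup.
- exact: count_agrees_shift.
- move: i; apply: (trace_ind (size pi)) => i => [lt_ni | le_in IHi].
    rewrite mu_Until dist_Until leqNgt lt_ni /=.
    (* [Dash] absorbs the success count of [phi1]; only its failure count remains to be bounded. *)
    have -> : sqcap (dist pi phi1 i) (Dash, Inf)
              = (Dash, Order.min (dist pi phi1 i).2 Inf).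
      by case: (dist pi phi1 i) => [[a||] f].
    apply: count_agrees_past_end => //.
    have [_ /andP[_]] := count_agrees_beyond _ _ _ _ lt_ni (IH1 i).
    by case: (dist pi phi1 i).2 => [b||] //; rewrite ncount_minE.
  rewrite mu_Until dist_Until le_in.
  by apply: count_agrees_sqcup => //; apply: count_agrees_sqcap => //;
    apply: count_agrees_shift.
- move: i; apply: (trace_ind (size pi)) => i => [lt_ni | le_in IHi].
    by rewrite mu_Finally dist_Finally leqNgt lt_ni; apply: count_agrees_past_end.
  rewrite mu_Finally dist_Finally le_in.
  by apply: count_agrees_sqcup => //; apply: count_agrees_shift.
Qed.

(** On an inconclusive count, predictions choose only among [PTop5], [PBot5] and [r], so [r] alone
    could project to a conclusive verdict. *)
Lemma project_eval_with phi i r :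
  (mu pi phi i = Unk3 -> project r = Unk3) ->
  project (eval_with pi phi i r) = mu pi phi i.
Proof.
have := dist_agrees phi i; rewrite /eval_with.
case: (mu pi phi i) (dist pi phi i) => [] [[a||] [b||]] //=;
  do ?[by move=> ->]; rewrite ?andbT ?andbF ?ltnNge => // dP /(_ erefl) rU;
  rewrite ?dP //.
- by case: ifP => // _; case: ifP.
- by case: (prediction pi phi i).
- by case: (prediction pi (Neg phi) i); rewrite /= ?neg5K.
Qed.

(** Restricted to inconclusive verdicts because [aux] is [Unk5] even on atoms whose verdict is
    decided. *)
Lemma project_aux phi i : mu pi phi i = Unk3 -> project (aux pi phi i) = Unk3.
Proof.
have evalE psi j : (mu pi psi j = Unk3 -> project (aux pi psi j) = Unk3) ->
    project (eval pi psi j) = mu pi psi j by exact: project_eval_with.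
elim: phi i => [p|phi IH|phi1 IH1 phi2 IH2|phi IH|phi1 IH1 phi2 IH2|phi IH] i.
- by [].
- by rewrite aux_Neg project_neg5 (evalE _ _ (IH i)).
- by rewrite aux_Or project_vee5 (evalE _ _ (IH1 i)) (evalE _ _ (IH2 i)).
- rewrite /=; case: ifP => _; first exact: IH.
  by move=> muU; rewrite (evalE _ _ (IH _)).
- move: i; apply: (trace_ind (size pi)) => i => [lt_ni | le_in IHi].
    by rewrite mu_Until aux_Until leqNgt lt_ni (evalE _ _ (IH2 i)).
  (* An [Until] has no leading [Next], so this [aux] is [eval] of the [Until] at [i.+1], where [IHi]
     applies. *)
  have nextE : project (aux pi (Next (Until phi1 phi2)) i)
               = mu pi (Next (Until phi1 phi2)) i by apply: (evalE (Until _ _)).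
  rewrite mu_Until aux_Until le_in project_vee5 project_wedge5.
  by rewrite (evalE _ _ (IH2 i)) (evalE _ _ (IH1 i)) evalE // nextE.
- move: i; apply: (trace_ind (size pi)) => i => [lt_ni | le_in IHi].
    by rewrite mu_Finally aux_Finally leqNgt lt_ni (evalE _ _ (IH i)).
  have nextE : project (aux pi (Next (Finally phi)) i)
               = mu pi (Next (Finally phi)) i by apply: (evalE (Finally _)).
  by rewrite mu_Finally aux_Finally le_in project_vee5 (evalE _ _ (IH i)) nextE.
Qed.

Lemma project_eval phi i : project (eval pi phi i) = mu pi phi i.
Proof. exact/project_eval_with/project_aux. Qed.

End Trace.

Theorem theorem1 (P : finType) (phi : formula P) (pi : seq {set P}) (i : nat)
    (i_gt0 : 0 < i) :
  [/\ mu pi phi i = Top3 <-> eval pi phi i = Top5,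
      mu pi phi i = Bot3 <-> eval pi phi i = Bot5
    & mu pi phi i = Unk3 <-> eval pi phi i \in [:: PTop5; PBot5; Unk5]].
(* The three equivalences are the fibres of [project]. *)
Proof. by rewrite -project_eval; case: eval. Qed.
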